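(* In the Jacobi setting of the context, let $\boldsymbol n\in\mathbb N_0^p$, $\boldsymbol m\in\mathbb N_0^q$ with $|\boldsymbol m|=|\boldsymbol n|+1$ and $|m_i-m_j|\le1$ for all $i,j$. Assume that the nodes $-b_j-\ell$ ($1\le j\le q$, $m_j\ge1$, $0\le\ell\le m_j-1$) are pairwise distinct and that no denominator in the finite formula $(\ast)$ of the context vanishes. Let $\mathcal B_{\boldsymbol n,\boldsymbol m}=\sum_{j=1}^qB^{(j)}_{\boldsymbol n,\boldsymbol m}w_j(\cdot;\boldsymbol a,\boldsymbol b)$ be the form described in the context, and let $j\in\{1,\dots,q\}$. If $m_j=0$ then $B^{(j)}_{\boldsymbol n,\boldsymbol m}\equiv0$. If $m_j\ge1$, then $$B^{(j)}_{\boldsymbol n,\boldsymbol m}(x)=\mathcal K_{j,j}\mathcal F_j(x)+\sum_{\substack{1\le J\le q\\ J\ne j,\ m_J\ge2}}\mathcal K_{j,J}\mathcal F_{j,J}(x),$$ where $$\mathcal K_{j,j}=-\frac{(\boldsymbol\alpha+(b_j+1)\mathbf 1_p)_{\boldsymbol n}}{(m_j-1)!\,(\boldsymbol b^{*j}-b_j\mathbf 1_{q-1})_{\boldsymbol m^{*j}}},$$ $$\mathcal F_j(x)=F^{p+q:1;q}_{p+q:0;q-1}\!\left[\begin{array}{c}1-m_j,\ \boldsymbol\alpha+(b_j+1)\mathbf 1_p+\boldsymbol n,\ b_j\mathbf 1_{q-1}-\boldsymbol b^{*j}+\mathbf 1_{q-1}-\boldsymbol m^{*j}\,:\,1;\ b_j\mathbf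 1_q-\boldsymbol a\\ \boldsymbol\alpha+(b_j+1)\mathbf 1_p,\ b_j\mathbf 1_q-\boldsymbol a+\mathbf 1_q\,:\,\text{---};\ b_j\mathbf 1_{q-1}-\boldsymbol b^{*j}\end{array}\middle|\,x,1\right],$$ and, for $J\ne j$ with $m_J\ge2$, $$\mathcal K_{j,J}=\frac1{(m_J-2)!}\,\frac{(\boldsymbol\alpha+(b_J+2)\mathbf 1_p)_{\boldsymbol n}}{(\boldsymbol b^{*J}-(b_J+1)\mathbf 1_{q-1})_{\boldsymbol m^{*J}}}\,\frac{(\boldsymbol a-b_j\mathbf 1_q)_1}{(\boldsymbol b^{*j}-b_j\mathbf 1_{q-1})_1}\,\frac{(\boldsymbol b^{*j}-(b_J+1)\mathbf 1_{q-1})_1}{(\boldsymbol a-(b_J+1)\mathbf 1_q)_1},$$ $$\mathcal F_{j,J}(x)=F^{p+q:1;q}_{p+q:0;q-1}\!\left[\begin{array}{c}2-m_J,\ \boldsymbol\alpha+(b_J+2)\mathbf 1_p+\boldsymbol n,\ b_J\mathbf 1_{q-1}-\boldsymbol b^{*J}+2\cdot\mathbf 1_{q-1}-\boldsymbol m^{*J}\,:\,1;\ b_J\mathbf 1_q-\boldsymbol a+\mathbf 1_q\\ \boldsymbol\alpha+(b_J+2)\mathbf 1_p,\ b_J\mathbf 1_q-\boldsymbol a+2\cdot\mathbf 1_q\,:\,\text{---};\ b_J\mathbf 1_{q-1}-\boldsymbol b^{*J}+\mathbf 1_{q-1}+\boldsymbol e_j^{*J}\end{array}\middle|\,x,1\right].$$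 Here $\boldsymbol e_j^{*J}$ is the $j$-th coordinate vector of $\mathbb R^q$ with its $J$-th component deleted. With $u$ and $\lambda$ denoting the two summation indices (powers of $x$ and of $1$), the parameter $1-m_j$ restricts $\mathcal F_j$ to $u+\lambda\le m_j-1$ and $2-m_J$ restricts $\mathcal F_{j,J}$ to $u+\lambda\le m_J-2$.
   Context: Conventions. $\mathbb N_0=\{0,1,2,\dots\}$; $\mathbb P_N$ is the space of complex polynomials of degree at most $N$ ($\{0\}$ if $N<0$). $(c)_k=c(c+1)\cdots(c+k-1)$. For $\boldsymbol c=(c_1,\dots,c_d)$, $\boldsymbol\nu\in\mathbb N_0^d$: $\Gamma(\boldsymbol c)=\prod_i\Gamma(c_i)$, $(\boldsymbol c)_k=\prod_i(c_i)_k$, $(\boldsymbol c)_{\boldsymbol\nu}=\prod_i(c_i)_{\nu_i}$, $|\boldsymbol\nu|=\sum\nu_i$; $\mathbf 1_d=(1,\dots,1)$; $\boldsymbol e_j$ is a coordinate vector; $\boldsymbol c^{*i}$ is $\boldsymbol c$ with the $i$-th entry deleted; empty products are $1$. ${}_uF_v(A;B;x)=\sum_k\frac{(A)_k}{(B)_k}\frac{x^k}{k!}$. $\mathcal M[f](s)=\int_0^\infty x^{s-1}f(x)dx$. Kampé de Fériet series: for parameter strings $\boldsymbol a,\boldsymbol b,\boldsymbol c,\boldsymbol d,\boldsymbol e,\boldsymbol f$ of lengths $p,q,k,\ell,m,n$ (possibly empty), $$F^{p:q;k}_{\ell:m;n}\!\left(\begin{matrix}\boldsymbol a:\boldsymbol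 b;\boldsymbol c\\ \boldsymbol d:\boldsymbol e;\boldsymbol f\end{matrix}\middle|x,y\right)=\sum_{u,\lambda\ge0}\frac{(\boldsymbol a)_{u+\lambda}(\boldsymbol b)_u(\boldsymbol c)_\lambda}{(\boldsymbol d)_{u+\lambda}(\boldsymbol e)_u(\boldsymbol f)_\lambda}\frac{x^u}{u!}\frac{y^\lambda}{\lambda!}.$$ Jacobi setting. $p,q\ge1$; $\boldsymbol a,\boldsymbol b\in\mathbb R^q$ with $-1<a_j<b_j$; $\boldsymbol\alpha\in\mathbb R^p$ with $\alpha_i+a_\rho>-1$ for all $i,\rho$. $\mathcal B_{a,b}(x)=x^a(1-x)^{b-a-1}/\Gamma(b-a)$ on $(0,1)$, $0$ elsewhere; $(f*g)(x)=\int_0^\infty f(t)g(x/t)dt/t$; $w_0(x;\boldsymbol a,\boldsymbol b)=\mathcal B_{a_1,b_1}*\cdots*\mathcal B_{a_q,b_q}(x)$; $w_j(x;\boldsymbol a,\boldsymbol b)=w_0(x;\boldsymbol a,\boldsymbol b+\boldsymbol e_j)$. The form. $\mathcal B_{\boldsymbol n,\boldsymbol m}=\sum_jB^{(j)}_{\boldsymbol n,\boldsymbol m}w_j$, with $B^{(j)}_{\boldsymbol n,\boldsymbol m}\in\mathbb P_{m_j-1}$, is the form with $\mathcal M[\mathcal B_{\boldsymbol n,\boldsymbol m}](s)=-\frac{\Gamma(s\mathbf 1_q+\boldsymbol a)}{\Gamma(s\mathbf 1_q+\boldsymbol b+\boldsymbol m)}(\boldsymbol\alpha+(1-s)\mathbf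 1_p)_{\boldsymbol n}$ (hence $\int_0^1\mathcal B_{\boldsymbol n,\boldsymbol m}x^{\alpha_i+r}dx=0$ for $0\le r<n_i$) whose components, for $m_j\ge1$, are $$(\ast)\quad B^{(j)}_{\boldsymbol n,\boldsymbol m}(x)=\sum_{\substack{1\le J\le q,\ 0\le K\le m_J-1\\ K-1+\delta_{j,J}\ge0}}\mathcal C_{j;J,K}\,{}_{q+1}F_q\!\left(\begin{matrix}1,\ \boldsymbol b+(1-b_J-K)\mathbf 1_q-\boldsymbol e_j\\ \boldsymbol a+(1-b_J-K)\mathbf 1_q\end{matrix};x\right)$$ (terminating at degree $K-1+\delta_{j,J}$), with $$\mathcal C_{j;J,K}=(-1)^{K+1}\frac{(\boldsymbol\alpha+(b_J+K+1)\mathbf 1_p)_{\boldsymbol n}}{K!(m_J-K-1)!(\boldsymbol b^{*J}-(b_J+K)\mathbf 1_{q-1})_{\boldsymbol m^{*J}}}\frac{(\boldsymbol a-b_j\mathbf 1_q)_1}{(\boldsymbol b^{*j}-b_j\mathbf 1_{q-1})_1}\frac{(\boldsymbol b^{*j}-(b_J+K)\mathbf 1_{q-1})_1}{(\boldsymbol a-(b_J+K)\mathbf 1_q)_1}.$$ Identities are understood as identities of meromorphic functions of the parameters wherever both sides are defined. *)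

(* Defs.v *)
From HB Require Import structures.
From mathcomp Require Import all_boot all_order all_algebra.
From mathcomp Require Import complex.
From mathcomp Require Import all_classical all_reals all_analysis.

Set Implicit Arguments.
Unset Strict Implicit.
Unset Printing Implicit Defensive.

Import Order.TTheory GRing.Theory Num.Theory.
Import numFieldNormedType.Exports.

Local Open Scope classical_set_scope.
Local Open Scope ring_scope.
Local Open Scope complex_scope.

Section Hypergeometric.
Variable F : numFieldType.

(* (c)_k = c (c + 1) ... (c + k - 1) *)
Definition poch (c : F) (k : nat) : F := \prod_(i < k) (c + i%:R).

(* (c)_k for a string c of parameters and a common index k *)
Definition pochs (c : seq F) (k : nat) : F := \prod_(z <- c) poch z k.

(* (c)_nu for a vector c and a multi-index nu *)
Definition mpoch d (c : 'I_d -> F) (nu : 'I_d -> nat) : F :=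
  \prod_i poch (c i) (nu i).

(* (c^{*J})_(nu^{*J}) : the J-th entries are deleted *)
Definition mpoch_del d (J : 'I_d) (c : 'I_d -> F) (nu : 'I_d -> nat) : F :=
  \prod_(i | i != J) poch (c i) (nu i).

Definition entries d (c : 'I_d -> F) : seq F := [seq c i | i <- enum 'I_d].

(* the string c^{*J} *)
Definition del d (J : 'I_d) (c : 'I_d -> F) : seq F :=
  [seq c i | i <- enum 'I_d & i != J].

(* Series are limits of partial sums.  Division by 0 yields 0, so a term whose
   numerator vanishes is 0 even where its denominator vanishes too: this is the
   usual convention for terminating series. *)
Definition pFq (A B : seq F) (x : F) : F :=
  limn (fun N : nat =>
    \sum_(k < N) pochs A k / pochs B k * (x ^+ k / (k`!)%:R)).

(* Kampe de Feriet series F[a : b; c / d : e; f | x, y], the double series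
   being summed over squares *)
Definition kdf (a b c d e f : seq F) (x y : F) : F :=
  limn (fun N : nat =>
    \sum_(u < N) \sum_(l < N)
      (pochs a (u + l) * pochs b u * pochs c l)
        / (pochs d (u + l) * pochs e u * pochs f l)
        * (x ^+ u / (u`!)%:R) * (y ^+ l / (l`!)%:R)).

Variables (p q : nat).
Variables (a b : 'I_q -> F) (alpha : 'I_p -> F).
Variables (n : 'I_p -> nat) (m : 'I_q -> nat).

(* the ratio (a - b_j)_1 / (b^{*j} - b_j)_1
               * (b^{*j} - (b_J + K))_1 / (a - (b_J + K))_1 *)
Definition ratio1 (j J : 'I_q) (K : nat) : F :=
  pochs (entries (fun i => a i - b j)) 1
    / pochs (del j (fun i => b i - b j)) 1
  * (pochs (del j (fun i => b i - (b J + K%:R))) 1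
    / pochs (entries (fun i => a i - (b J + K%:R))) 1).

(* the coefficient C_{j; J, K} *)
Definition coefC (j J : 'I_q) (K : nat) : F :=
  (-1) ^+ K.+1
  * (mpoch (fun i => alpha i + (b J + K%:R + 1)) n
     / ((K`!)%:R * ((m J - K - 1)`!)%:R
        * mpoch_del J (fun i => b i - (b J + K%:R)) m))
  * ratio1 j J K.

(* the finite formula for B^{(j)}; the condition on (J, K) is
   K - 1 + delta_{j,J} >= 0 *)
Definition formula (j : 'I_q) (x : F) : F :=
  \sum_(J < q) \sum_(K < m J | (1 <= K + (j == J))%N)
    coefC j J K
    * pFq (1 :: entries (fun i => b i + (1 - b J - K%:R) - (i == j)%:R))
          (entries (fun i => a i + (1 - b J - K%:R))) x.

(* no denominator of formula j vanishes, for any j with m_j >= 1; the series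
   in formula j has terms of degree k <= K - 1 + delta_{j,J} only *)
Definition formula_defined : Prop :=
  forall j : 'I_q, (0 < m j)%N ->
  pochs (del j (fun i => b i - b j)) 1 != 0 /\
  forall (J : 'I_q) (K : nat), (K < m J)%N -> (1 <= K + (j == J))%N ->
  [/\ mpoch_del J (fun i => b i - (b J + K%:R)) m != 0,
      pochs (entries (fun i => a i - (b J + K%:R))) 1 != 0
    & forall k : nat, (k < K + (j == J))%N ->
        pochs (entries (fun i => a i + (1 - b J - K%:R))) k != 0].

Definition Kdiag (j : 'I_q) : F :=
  - (mpoch (fun i => alpha i + (b j + 1)) n
     / (((m j - 1)`!)%:R * mpoch_del j (fun i => b i - b j) m)).

Definition top_diag (j : 'I_q) : seq F :=
  (1 - (m j)%:R) :: entries (fun i => alpha i + (b j + 1) + (n i)%:R)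
    ++ del j (fun i => b j - b i + 1 - (m i)%:R).

Definition Fdiag (j : 'I_q) (x : F) : F :=
  kdf (top_diag j) [:: 1] (entries (fun i => b j - a i))
      (entries (fun i => alpha i + (b j + 1))
        ++ entries (fun i => b j - a i + 1))
      [::] (del j (fun i => b j - b i))
      x 1.

Definition Koff (j J : 'I_q) : F :=
  1 / ((m J - 2)`!)%:R
  * (mpoch (fun i => alpha i + (b J + 2)) n
     / mpoch_del J (fun i => b i - (b J + 1)) m)
  * ratio1 j J 1.

Definition top_off (J : 'I_q) : seq F :=
  (2 - (m J)%:R) :: entries (fun i => alpha i + (b J + 2) + (n i)%:R)
    ++ del J (fun i => b J - b i + 2 - (m i)%:R).

Definition Foff (j J : 'I_q) (x : F) : F :=
  kdf (top_off J) [:: 1] (entries (fun i => b J - a i + 1))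
      (entries (fun i => alpha i + (b J + 2))
        ++ entries (fun i => b J - a i + 2))
      [::] (del J (fun i => b J - b i + 1 + (i == j)%:R))
      x 1.

End Hypergeometric.

Section Form.
Variable R : realType.

Let mu := @lebesgue_measure R.

(* x ^ s for x > 0 *)
Definition cpow (x : R) (s : R[i]) : R[i] :=
  (x `^ complex.Re s)%:C * (cos (complex.Im s * ln x) +i* sin (complex.Im s * ln x)).

(* the integral over (0, +oo) of a complex-valued function *)
Definition cintegral (f : R -> R[i]) : R[i] :=
  (\int[mu]_(x in `]0, +oo[) complex.Re (f x)) +i* (\int[mu]_(x in `]0, +oo[) complex.Im (f x)).

Definition mellin (f : R -> R[i]) (s : R[i]) : R[i] :=
  cintegral (fun x => cpow x (s - 1) * f x).

(* Euler's integral, used only for Re s > 0 *)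
Definition cGamma (s : R[i]) : R[i] := mellin (fun x => (expR (- x))%:C) s.

Definition rGamma (s : R) : R :=
  \int[mu]_(x in `]0, +oo[) (x `^ (s - 1) * expR (- x)).

Definition beta_density (a b x : R) : R :=
  if (0 < x) && (x < 1) then
    x `^ a * (1 - x) `^ (b - a - 1) / rGamma (b - a)
  else 0.

Definition mconv (f g : R -> R) (x : R) : R :=
  \int[mu]_(t in `]0, +oo[) (f t * g (x / t) / t).

Definition w0 q (a b : 'I_q -> R) : R -> R :=
  match [seq beta_density (a i) (b i) | i <- enum 'I_q] with
  | f :: fs => foldl mconv f fs
  | [::] => fun=> 0
  end.

Definition w q (a b : 'I_q -> R) (j : 'I_q) : R -> R :=
  w0 a (fun i => b i + (i == j)%:R).

Definition linear_form q (a b : 'I_q -> R) (B : 'I_q -> {poly R[i]}) (x : R)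
    : R[i] :=
  \sum_j (B j).[x%:C] * (w a b j x)%:C.

Definition emb d (c : 'I_d -> R) : 'I_d -> R[i] := fun i => (c i)%:C.

(* B lists the components of the form: B^{(j)} has degree at most m_j - 1, the
   Mellin transform is prescribed on its half-plane of convergence
   Re s > - min_j a_j, and the components are given by the finite formula. *)
Definition is_form p q (a b : 'I_q -> R) (alpha : 'I_p -> R)
    (n : 'I_p -> nat) (m : 'I_q -> nat) (B : 'I_q -> {poly R[i]}) : Prop :=
  [/\ forall j, (size (B j) <= m j)%N,
      forall s : R[i], (forall j, - a j < complex.Re s) ->
        mellin (linear_form a b B) s =
        - ((\prod_j cGamma (s + (a j)%:C))
           / (\prod_j cGamma (s + (b j)%:C + (m j)%:R))
           * mpoch (fun i => (alpha i)%:C + (1 - s)) n)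
    & forall j, (0 < m j)%N -> forall x : R[i],
        (B j).[x] = formula (emb a) (emb b) (emb alpha) n m j x].

End Form.

(* Main.v *)
Require Import Defs.
From HB Require Import structures.
From mathcomp Require Import all_boot all_order all_algebra.
From mathcomp Require Import complex ring lra zify.
From mathcomp Require Import all_classical all_reals all_analysis.

Import Order.TTheory GRing.Theory Num.Theory.
Import numFieldNormedType.Exports.
Local Open Scope ring_scope.
Local Open Scope complex_scope.

(* Compare the coefficients of x^u.  In the pair (J, K) of the finite formula
   put K = u + l if J = j and K = u + l + 1 if J <> j: the triangle u <= K
   becomes the index set of the Kampe de Feriet sum, and the reflection
   (c - k)_k = (-1)^k (1 - c)_k turns every Pochhammer symbol in which K shifts
   the base into one in which K is the length.  The signs cancel, because there
   are as many factors (-1)^u from the a's as from the b's.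

   The condition |m_i - m_j| <= 1 is used for m_i = 0 only: then no node of
   index i excludes b_i - b_J = k, but m_J <= 1 leaves only k = 0, which is
   excluded by the denominators of the formula. *)

(** * Truncation and reindexing of finite sums *)

Section Sums.
Variable V : nmodType.

Lemma sum_ord_support (g : nat -> V) (M N : nat) :
  (forall k, (M <= k)%N -> g k = 0) -> (M <= N)%N ->
  \sum_(k < N) g k = \sum_(k < M) g k.
Proof.
move=> g0 MN; rewrite -!(big_mkord xpredT g) (big_cat_nat (n := M)) //=.
rewrite [X in _ + X]big_nat_cond [X in _ + X]big1 ?addr0 // => k.
by case/andP=> /andP[Mk _] _; exact: g0.
Qed.

(** Exchange the sums over the triangle [u <= K < M], then put [K = u + l] in the inner one. *)
Lemma sum_triangle (f : nat -> nat -> V) (M : nat) :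
  \sum_(K < M) \sum_(u < K.+1) f K u =
  \sum_(u < M) \sum_(l < M | (u + l < M)%N) f (u + l)%N u.
Proof.
transitivity (\sum_(K < M) \sum_(u < M | (u <= K)%N) f K u).
  apply: eq_bigr => K _.
  by rewrite (big_ord_widen_cond M xpredT (fun u => f K u)) // ltn_ord.
rewrite (exchange_big_dep xpredT) //=; apply: eq_bigr => u _.
have uM := ltn_ord u.
rewrite -(big_mkord (fun K => (u <= K)%N) (fun K => f K u)) big_nat_cond.
rewrite -(big_mkord (fun l => (u + l < M)%N) (fun l => f (u + l)%N u)).
rewrite [RHS]big_nat_cond.
transitivity (\sum_(u <= K < M) f K u).
  rewrite [RHS](big_nat_widenl _ 0) // [RHS]big_nat_cond.
  by apply: eq_bigl => K; rewrite andTb.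
rewrite -{1}[nat_of_ord u]add0n big_addn.
rewrite (big_nat_widen _ _ M) ?leq_subr // big_nat_cond.
apply: eq_big => [l|l _]; first by rewrite /= ltn_subRL.
by rewrite addnC.
Qed.

End Sums.

(** * Terminating series as finite sums *)

Section Limits.
Variable F : numFieldType.

Lemma limn_near_cst (g : nat -> F) (c : F) (M : nat) :
  (forall N, (M <= N)%N -> g N = c) -> limn g = c.
Proof.
move=> gE; apply: lim_near_cst; first exact: norm_hausdorff.
by exists M => // N /= MN; exact: gE.
Qed.

Lemma pFq_finite (A B : seq F) (x : F) (M : nat) :
  (forall k, (M <= k)%N -> pochs A k = 0) ->
  pFq A B x = \sum_(k < M) pochs A k / pochs B k * (x ^+ k / (k`!)%:R).
Proof.
move=> A0; apply: (@limn_near_cst _ _ M) => N MN.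
apply: (@sum_ord_support _
  (fun k => pochs A k / pochs B k * (x ^+ k / (k`!)%:R))) MN => k Mk.
by rewrite A0 // !mul0r.
Qed.

(** As [a] has index [u + l], its vanishing confines the terms to the triangle [u + l < M], which
    every square of side [N >= M] contains. A zero numerator kills a term even where its denominator
    is 0. *)
Lemma kdf_finite (a b c d e f : seq F) (x y : F) (M : nat) :
  (forall k, (M <= k)%N -> pochs a k = 0) ->
  kdf a b c d e f x y =
  \sum_(u < M) \sum_(l < M | (u + l < M)%N)
      (pochs a (u + l) * pochs b u * pochs c l)
        / (pochs d (u + l) * pochs e u * pochs f l)
        * (x ^+ u / (u`!)%:R) * (y ^+ l / (l`!)%:R).
Proof.
move=> a0; apply: (@limn_near_cst _ _ M) => N MN.
set t := fun u l : nat => (pochs a (u + l) * pochs b u * pochs c l)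
        / (pochs d (u + l) * pochs e u * pochs f l)
        * (x ^+ u / (u`!)%:R) * (y ^+ l / (l`!)%:R).
have t0 u l : (M <= u + l)%N -> t u l = 0 by move=> h; rewrite /t a0 // !mul0r.
rewrite (@sum_ord_support _ (fun u => \sum_(l < N) t u l) M) //; last first.
  by move=> u Mu; rewrite big1 // => l _; rewrite t0 //; lia.
apply: eq_bigr => u _.
rewrite (@sum_ord_support _ (t u) M) //; last by move=> l ?; rewrite t0 //; lia.
rewrite [RHS]big_mkcond; apply: eq_bigr => l _.
by case: ltnP => // /t0.
Qed.

End Limits.

(** * Pochhammer identities for one parameter at a time *)

Section Pochhammer.
Variable F : numFieldType.
Implicit Types (c d : F) (k l u m : nat).

Lemma poch0 c : poch c 0 = 1.
Proof. by rewrite /poch big_ord0. Qed.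

Lemma pochS c k : poch c k.+1 = poch c k * (c + k%:R).
Proof. by rewrite /poch big_ord_recr. Qed.

Lemma poch1 c : poch c 1 = c.
Proof. by rewrite pochS poch0 mul1r addr0. Qed.

Lemma pochD c k l : poch c (k + l) = poch c k * poch (c + k%:R) l.
Proof.
elim: l => [|l IH]; first by rewrite addn0 poch0 mulr1.
by rewrite addnS !pochS IH natrD; ring.
Qed.

Lemma pochSl c k : poch c k.+1 = c * poch (c + 1) k.
Proof. by rewrite -add1n pochD poch1. Qed.

Lemma poch_neq0 c k :
  (forall l, (l < k)%N -> c + l%:R != 0) -> poch c k != 0.
Proof. by move=> h; apply/prodf_neq0 => l _; exact: h. Qed.

Lemma poch_eq0 c k l : (l < k)%N -> c + l%:R = 0 -> poch c k = 0.
Proof.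
by move=> lk c0; apply/eqP/prodf_eq0; exists (Ordinal lk) => //; apply/eqP.
Qed.

Lemma poch_reflect c k : poch (c - k%:R) k = (-1) ^+ k * poch (1 - c) k.
Proof.
elim: k c => [|k IH] c; first by rewrite !poch0 mulr1.
rewrite pochSl pochS -natr1 exprS.
have -> : c - (k%:R + 1) + 1 = c - k%:R by ring.
by rewrite IH; ring.
Qed.

Lemma poch_1 k : poch (1 : F) k = (k`!)%:R.
Proof.
elim: k => [|k IH]; first by rewrite poch0.
by rewrite pochS IH factS natrM mulrC -natr1 addrC.
Qed.

Lemma fact_neq0 k : (k`!)%:R != 0 :> F.
Proof. by rewrite pnatr_eq0 -lt0n fact_gt0. Qed.

(** Both sides are [poch c (k + m)], split in two ways. *)
Lemma poch_shift c k m :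
  poch (c + k%:R) m * poch c k = poch c m * poch (c + m%:R) k.
Proof. by rewrite mulrC -!pochD addnC. Qed.

Lemma poch_oppnat u l :
  poch (- (u + l)%:R) u * (l`!)%:R = (-1) ^+ u * ((u + l)`!)%:R :> F.
Proof.
have -> : - (u + l)%:R = (- l%:R) - u%:R :> F by rewrite natrD; ring.
rewrite poch_reflect opprK -mulrA; congr (_ * _).
by rewrite mulrC -!poch_1 addnC pochD.
Qed.

(** The terminating parameter of the inner series and the factorial from [coefC] combine into the
    [1 / l!] of the double series. *)
Lemma poch_oppnat_fact u l :
  ((u + l)`!)%:R^-1 * poch (- (u + l)%:R) u = (-1) ^+ u * (l`!)%:R^-1 :> F.
Proof.
have h := poch_oppnat u l; have l0 := fact_neq0 l.
rewrite -[poch _ _](mulfK l0) h [RHS]mulrC; field.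
by rewrite l0 fact_neq0.
Qed.

(** This is [poch_oppnat] with [u = k] and [u + l = m - 1]. It produces the parameter [1 - m_j], and
    [2 - m_J] when applied to [m_J - 1]. *)
Lemma fact_sub_poch m k : (k < m)%N ->
  ((m - k - 1)`!)%:R^-1 =
    (-1) ^+ k * poch (1 - m%:R) k / ((m - 1)`!)%:R :> F.
Proof.
move=> km; have := @poch_oppnat k (m - k - 1).
have -> : (k + (m - k - 1) = m - 1)%N by lia.
rewrite natrB; last by lia.
rewrite opprB => h; have f0 := fact_neq0 (m - k - 1).
have f1 := fact_neq0 (m - 1).
have -> : poch (1 - m%:R) k =
   (-1) ^+ k * ((m - 1)`!)%:R / ((m - k - 1)`!)%:R :> F.
  by apply: (canRL (mulfK f0)).
rewrite !mulrA -expr2 sqrr_sign mul1r -mulrA mulrC -mulrA mulVf ?mulr1 //.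
Qed.

(** The contribution of one [a_i], with [d = b_j - a_i] or [d = b_J - a_i + 1]. After reflection it
    amounts to two factorizations of [poch d (u + l).+1]. *)
Lemma ratio_factor d u l :
  (forall k, (k <= u + l)%N -> d + k%:R != 0) ->
  (- d) / (- d - (u + l)%:R) / poch (1 - d - (u + l)%:R) u =
  poch d l / poch (d + 1) (u + l) * (-1) ^+ u.
Proof.
(* Reflection will put its sign in the denominator, so the sign on the right is written as its own
   inverse. *)
rewrite -[in RHS]invr_sign.
move=> d0.
have -> : 1 - d - (u + l)%:R = (1 - d - l%:R) - u%:R by rewrite natrD; ring.
rewrite poch_reflect.
have -> : 1 - (1 - d - l%:R) = d + l%:R by ring.
have p0 : poch (d + 1) (u + l) != 0.
  by apply: poch_neq0 => k kl; rewrite -addrA nat1r d0 //; lia.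
have q0 : poch (d + l%:R) u != 0.
  by apply: poch_neq0 => k kl; rewrite -addrA -natrD d0 //; lia.
have e : d * poch (d + 1) (u + l) =
         poch d l * poch (d + l%:R) u * (d + (u + l)%:R).
  by rewrite -pochSl pochS addnC pochD.
have k0 := d0 _ (leqnn (u + l)).
have n0 : - d - (u + l)%:R != 0 by rewrite -opprD oppr_eq0.
have s0 : (-1) ^+ u != 0 :> F by rewrite signr_eq0.
apply: (mulIf p0); rewrite -!mulrA [in LHS]invfM.
have -> : - d * ((- d - (u + l)%:R)^-1 *
    ((-1) ^- u * (poch (d + l%:R) u)^-1 * poch (d + 1) (u + l))) =
  (d * poch (d + 1) (u + l)) / (d + (u + l)%:R) / (-1) ^+ u / poch (d + l%:R) u.
  by field; rewrite -natrD k0 n0 s0 q0.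
by rewrite e; field; rewrite -?natrD k0 s0 q0 p0.
Qed.

(** The contribution of one [b_i]. In [poch_shift] based at [c - (u + l)], reflecting both symbols
    of length [u + l] moves the shift from the base to the length. *)
Lemma shifted_factor c m u l :
  (forall k, (0 < k <= u + l)%N -> k%:R - c != 0) ->
  poch c m != 0 -> poch (c - (u + l)%:R) m != 0 ->
  poch (c - (u + l)%:R) u / poch (c - (u + l)%:R) m =
  poch (1 - c - m%:R) (u + l) / poch c m / poch (1 - c) l * (-1) ^+ u.
Proof.
move=> c0 m0 k0.
have p0 k : (k <= u + l)%N -> poch (1 - c) k != 0.
  move=> kl; apply: poch_neq0 => i ik; rewrite addrAC nat1r.
  by rewrite c0 //; lia.
have e1 : poch (1 - c) (u + l) = poch (1 - c) l * poch (1 - c + l%:R) u.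
  by rewrite addnC pochD.
have e2 : poch (c - (u + l)%:R) u = (-1) ^+ u * poch (1 - c + l%:R) u.
  have -> : c - (u + l)%:R = c - l%:R - u%:R by rewrite natrD; ring.
  by rewrite poch_reflect; congr (_ * poch _ _); ring.
have := poch_shift (c - (u + l)%:R) (u + l) m.
rewrite subrK poch_reflect.
have -> : c - (u + l)%:R + m%:R = c + m%:R - (u + l)%:R by ring.
rewrite poch_reflect => e3.
(* Both reflections give this same sign, which cancels. *)
have s0 : (-1) ^+ (u + l) != 0 :> F by rewrite signr_eq0.
have {}e3 : poch c m * poch (1 - c) (u + l) =
            poch (c - (u + l)%:R) m * poch (1 - c - m%:R) (u + l).
  apply: (mulfI s0); rewrite mulrCA e3 opprD addrA; ring.
have -> : poch (1 - c - m%:R) (u + l) =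
   poch c m * poch (1 - c) (u + l) / poch (c - (u + l)%:R) m.
  by rewrite e3 mulrC mulKf.
have pl := p0 l (leq_addl _ _).
by rewrite e2 e1; field; rewrite m0 k0 pl.
Qed.

(** The version with the linear factor from the numerator of [ratio1]. That factor extends the
    symbol to length [u.+1], with last factor [c - l]; the latter changes [1 - c] into [- c] in the
    denominator. *)
Lemma shifted_factorS c m u l :
  (forall k, (k <= u + l)%N -> k%:R - c != 0) ->
  poch c m != 0 -> poch (c - (u + l)%:R) m != 0 ->
  (c - (u + l)%:R) * poch (c + 1 - (u + l)%:R) u / poch (c - (u + l)%:R) m =
  c * poch (1 - c - m%:R) (u + l) / poch c m / poch (- c) l * (-1) ^+ u.
Proof.
move=> c0 m0 k0.
have -> : (c - (u + l)%:R) * poch (c + 1 - (u + l)%:R) u =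
          poch (c - (u + l)%:R) u * (c - l%:R).
  have -> : c + 1 - (u + l)%:R = c - (u + l)%:R + 1 by ring.
  by rewrite -pochSl pochS natrD; congr (_ * _); ring.
rewrite mulrAC shifted_factor //; last by move=> k /andP[_ /c0].
have := pochSl (- c) l; rewrite pochS => e.
have pl : poch (1 - c) l != 0.
  by apply: poch_neq0 => i ik; rewrite addrAC nat1r c0 //; lia.
have pc : poch (- c) l != 0.
  by apply: poch_neq0 => i ik; rewrite addrC c0 //; lia.
(* Obtained by splitting [poch (- c) l.+1] at either end. *)
have -> : c - l%:R = c * poch (1 - c) l / poch (- c) l.
  apply: (canRL (mulfK pc)); rewrite [1 - c]addrC.
  by rewrite -[RHS]opprK -mulNr -e; ring.
by field; rewrite m0 pl pc.
Qed.

(** Of these [2 q] equal signs, [q] come from the [a_i], [q - 1] from the [b_i] and one from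
    [poch_oppnat_fact]. *)
Lemma prod_signs q (j : 'I_q) u :
  \prod_(i < q) (-1) ^+ u * \prod_(i < q | i != j) (-1) ^+ u * (-1) ^+ u
    = 1 :> F.
Proof.
rewrite (bigD1 j) //=; set S := \prod_(i < q | i != j) _.
have SS : S * S = 1.
  by rewrite -big_split big1 // => i _; rewrite /= -expr2 sqrr_sign.
by rewrite -[_ * S * S]mulrA SS mulr1 -expr2 sqrr_sign.
Qed.

End Pochhammer.

(** * Pochhammer products over parameter strings *)

Section Strings.
Variable F : numFieldType.

Lemma pochs_cons (c : F) s k : pochs (c :: s) k = poch c k * pochs s k.
Proof. by rewrite /pochs big_cons. Qed.

Lemma pochs_cat (s t : seq F) k : pochs (s ++ t) k = pochs s k * pochs t k.
Proof. by rewrite /pochs big_cat. Qed.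

Lemma pochs_nil k : pochs ([::] : seq F) k = 1.
Proof. by rewrite /pochs big_nil. Qed.

Lemma pochs_entries d (c : 'I_d -> F) k :
  pochs (entries c) k = \prod_i poch (c i) k.
Proof. by rewrite /pochs /entries big_map big_enum. Qed.

Lemma pochs_del d (J : 'I_d) (c : 'I_d -> F) k :
  pochs (del J c) k = \prod_(i | i != J) poch (c i) k.
Proof. by rewrite /pochs /del big_map big_filter big_enum_cond. Qed.

(** Entrywise [poch_shift]: the shift in the base of the [alpha] symbols of [coefC] becomes the
    length of two symbols. *)
Lemma mpoch_shift d (c : 'I_d -> F) (nu : 'I_d -> nat) N :
  (forall i k, c i + k%:R != 0) ->
  mpoch (fun i => c i + N%:R) nu =
  mpoch c nu * (\prod_i poch (c i + (nu i)%:R) N / \prod_i poch (c i) N).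
Proof.
move=> c0; rewrite -prodf_div -big_split; apply: eq_bigr => i _ /=.
have c1 : poch (c i) N != 0 by apply: poch_neq0.
by rewrite mulrA -poch_shift mulfK.
Qed.

End Strings.

(** * Comparison of coefficients *)

Section Coefficients.
Variables (F : numFieldType) (p q : nat).
Variables (a b : 'I_q -> F) (alpha : 'I_p -> F).
Variables (n : 'I_p -> nat) (m : 'I_q -> nat).

(** Factors that the comparison cancels. They are kept as hypotheses so that it takes place in any
    numeric field. *)
Hypothesis alpha_neq0 : forall i J k, alpha i + (b J + 1) + k%:R != 0.
Hypothesis a_neq0 : forall i J k, (k < m J)%N -> b J - a i + k%:R != 0.
Hypothesis b_neq0 : forall i J k, i != J -> (k < m J)%N ->
  k%:R - (b i - b J) != 0.
Hypothesis m_neq0 : forall i J k, i != J -> (k < m J)%N ->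
  poch (b i - (b J + k%:R)) (m i) != 0.

Definition formula_coef (j J : 'I_q) (K u : nat) (x : F) : F :=
  Defs.coefC a b alpha n m j J K *
    (pochs (1 :: entries (fun i => b i + (1 - b J - K%:R) - (i == j)%:R)) u
      / pochs (entries (fun i => a i + (1 - b J - K%:R))) u
      * (x ^+ u / (u`!)%:R)).

(** The factors in [a], [b], [alpha] and the factorials are converted separately, in [eA], [eB],
    [eC] and [eN]. The index [i = j] is absent from [eB]: its upper parameter is [- K], which [eN]
    handles. *)
Lemma diag_coef (j : 'I_q) (u l : nat) (x : F) : (u + l < m j)%N ->
  formula_coef j j (u + l) u x =
  Kdiag b alpha n m j *
    ((pochs (top_diag b alpha n m j) (u + l) * pochs [:: 1] u
        * pochs (entries (fun i => b j - a i)) l)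
      / (pochs (entries (fun i => alpha i + (b j + 1))
                 ++ entries (fun i => b j - a i + 1)) (u + l)
         * pochs [::] u * pochs (del j (fun i => b j - b i)) l)
      * (x ^+ u / (u`!)%:R) * (1 ^+ l / (l`!)%:R)).
Proof.
move=> Nm; set N := (u + l)%N.
have eN := poch_oppnat_fact F u l; rewrite -/N in eN.
have eA : \prod_i (a i - b j) / \prod_i (a i - (b j + N%:R))
    / \prod_i poch (a i + (1 - b j - N%:R)) u =
    \prod_i poch (b j - a i) l / \prod_i poch (b j - a i + 1) N
    * \prod_(i < q) (-1) ^+ u.
  rewrite -!prodf_div -big_split; apply: eq_bigr => i _ /=.
  rewrite -ratio_factor => [|k kN]; last by apply: a_neq0; lia.
  by rewrite -/N; congr (_ / _ / poch _ _); ring.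
have eB : \prod_(i | i != j) (b i - (b j + N%:R))
    * \prod_(i | i != j) poch (b i + (1 - b j - N%:R) - (i == j)%:R) u
    / \prod_(i | i != j) poch (b i - (b j + N%:R)) (m i)
    / \prod_(i | i != j) (b i - b j) =
    \prod_(i | i != j) poch (b j - b i + 1 - (m i)%:R) N
    / \prod_(i | i != j) poch (b i - b j) (m i)
    / \prod_(i | i != j) poch (b j - b i) l
    * \prod_(i | i != j) (-1) ^+ u.
  rewrite -!(big_split, prodf_div); apply: eq_bigr => i ij /=.
  have c0 := b_neq0 _ _ _ ij (leq_ltn_trans (leq0n _) Nm).
  rewrite sub0r oppr_eq0 in c0.
  have := @shifted_factorS F (b i - b j) (m i) u l; rewrite -/N => H.
  (* The denominator [b i - b j] from [ratio1] is matched by the factor [c] on the right of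
     [shifted_factorS]. *)
  apply: (mulfI c0); rewrite mulrC divfK //.
  have -> : b i - (b j + N%:R) = b i - b j - N%:R by ring.
  have -> : b i + (1 - b j - N%:R) - (i == j)%:R = b i - b j + 1 - N%:R.
    by rewrite (negbTE ij) subr0; ring.
  rewrite H.
  - by rewrite !mulrA; congr (_ * poch _ _ / _ / poch _ _ * _); ring.
  - by move=> k kN; apply: b_neq0 => //; lia.
  - have := m_neq0 _ _ _ ij (leq_ltn_trans (leq0n _) Nm).
    by rewrite addr0.
  - by have := m_neq0 _ _ _ ij Nm; rewrite opprD addrA.
have sE := prod_signs F _ j u.
have sN : (-1) ^+ N * (-1) ^+ N = 1 :> F by rewrite -expr2 sqrr_sign.
have eC : mpoch (fun i => alpha i + (b j + N%:R + 1)) n =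
  mpoch (fun i => alpha i + (b j + 1)) n *
  (\prod_i poch (alpha i + (b j + 1) + (n i)%:R) N
     / \prod_i poch (alpha i + (b j + 1)) N).
  rewrite -mpoch_shift // /mpoch; apply: eq_bigr => i _; congr poch; ring.
rewrite /formula_coef /Defs.coefC /Kdiag /top_diag /ratio1 /mpoch_del.
rewrite !(pochs_cons, pochs_cat, pochs_entries, pochs_del, pochs_nil).
rewrite expr1n !mul1r eC.
under [\prod_i poch (a i - b j) 1]eq_bigr do rewrite poch1.
under [\prod_(i < q | _) poch (b i - b j) 1]eq_bigr do rewrite poch1.
under [\prod_i poch (a i - _) 1]eq_bigr do rewrite poch1.
under [\prod_(i < q | _) poch (b i - _) 1]eq_bigr do rewrite poch1.
rewrite [\prod_i poch (b i + _ - _) u](bigD1 j) //= eqxx.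
have -> : b j + (1 - b j - N%:R) - 1%:R = - N%:R by ring.
rewrite !invfM fact_sub_poch // exprS.
move: eN eA eB sE sN.
set s := (-1) ^+ u; set sg := (-1) ^+ N.
set S := \prod_(i < q) s; set S' := \prod_(i < q | i != j) s.
set A0 := \prod_i (a i - b j); set AN := \prod_i (a i - (b j + N%:R)).
set Au := \prod_i poch (a i + _) u.
set Bu := \prod_(i | i != j) poch (b i + _ - _) u.
set BN := \prod_(i | i != j) (b i - (b j + N%:R)).
set B0 := \prod_(i | i != j) (b i - b j).
set MN := \prod_(i | i != j) poch (b i - (b j + N%:R)) (m i).
set M0 := \prod_(i | i != j) poch (b i - b j) (m i).
set Al := \prod_i poch (b j - a i) l; set AlN := \prod_i poch (_ + 1) N.
set Bl := \prod_(i | i != j) poch (b j - b i) l.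
set T := \prod_(i | i != j) poch _ N.
set al := mpoch _ _; set alN := \prod_(i < p) poch (_ + _%:R) N.
set al0 := \prod_(i < p) poch _ N.
set f := (N`!)%:R^-1; set f' := (l`!)%:R^-1; set g := ((m j - 1)`!)%:R^-1.
set X := x ^+ u / _; set t := poch (1 - (m j)%:R) N.
set k := poch 1 u; set z := poch (- N%:R) u.
move=> eN eA eB sE sN.
(* The sign [(-1) ^+ N.+1] of [coefC] times the [(-1) ^+ N] of [fact_sub_poch] leaves the minus sign
   of [Kdiag]. *)
transitivity (- (sg * sg) * al * alN / al0 * t * g * k * X * (f * z)
   * (A0 / AN / Au) * (BN * Bu / MN / B0)); first by ring.
rewrite sN eN eA eB invr1 !mulr1 -[RHS]mulr1 -[X in _ = _ * X]sE; ring.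
Qed.

(** The terms start at [K = 1], so the factors at [b_J + 1] go into [Koff], and the one-parameter
    lemmas are used with [d = b_J - a_i + 1] and [c = b_i - b_J - 1]. *)
Lemma off_coef (j J : 'I_q) (u l : nat) (x : F) : J != j ->
  ((u + l).+1 < m J)%N ->
  formula_coef j J (u + l).+1 u x =
  Koff a b alpha n m j J *
    ((pochs (top_off b alpha n m J) (u + l) * pochs [:: 1] u
        * pochs (entries (fun i => b J - a i + 1)) l)
      / (pochs (entries (fun i => alpha i + (b J + 2))
                 ++ entries (fun i => b J - a i + 2)) (u + l)
         * pochs [::] u * pochs (del J (fun i => b J - b i + 1 + (i == j)%:R)) l)
      * (x ^+ u / (u`!)%:R) * (1 ^+ l / (l`!)%:R)).
Proof.
move=> Jj; set N := (u + l)%N => Nm.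
have eN := poch_oppnat_fact F u l; rewrite -/N in eN.
have KE : N.+1%:R = N%:R + 1 :> F by rewrite -natr1.
have eA : (\prod_i (a i - (b J + N.+1%:R)))^-1
    / \prod_i poch (a i + (1 - b J - N.+1%:R)) u =
    (\prod_i (a i - (b J + 1)))^-1
    * (\prod_i poch (b J - a i + 1) l / \prod_i poch (b J - a i + 2) N)
    * \prod_(i < q) (-1) ^+ u.
  rewrite -!prodfV -!(big_split, prodf_div); apply: eq_bigr => i _ /=.
  have d0 : - (b J - a i + 1) != 0.
    by rewrite oppr_eq0; apply: (a_neq0 i J 1); lia.
  have := @ratio_factor F (b J - a i + 1) u l; rewrite -/N => H.
  have -> : a i - (b J + 1) = - (b J - a i + 1) by ring.
  rewrite -[RHS]mulrA; apply: (mulfI d0); rewrite mulVKf //.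
  have -> : b J - a i + 2 = b J - a i + 1 + 1 by ring.
  rewrite -H => [|k kN]; last first.
    by rewrite -addrA nat1r; apply: a_neq0; lia.
  by rewrite KE mulrA; congr (_ / _ / poch _ _); ring.
(* The factor of index [J] will be [- K]. Putting 1 at the missing index [j] lets the rest run over
   [i != J], like the other products in [b]. *)
have dj (f : 'I_q -> F) : \prod_(i | i != j) f i =
    f J * \prod_(i | i != J) (if i == j then 1 else f i).
  rewrite (bigD1 J) //=; congr (_ * _).
  rewrite (eq_bigl (fun i => (i != J) && (i != j))); last first.
    by move=> i; rewrite andbC.
  by rewrite big_mkcondr; apply: eq_bigr => i _; rewrite if_neg.
have eB : \prod_(i | i != J) (if i == j then 1 else b i - (b J + N.+1%:R))
    * \prod_(i | i != J) poch (b i + (1 - b J - N.+1%:R) - (i == j)%:R) u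
    / \prod_(i | i != J) poch (b i - (b J + N.+1%:R)) (m i) =
    \prod_(i | i != J) (if i == j then 1 else b i - (b J + 1))
    * (\prod_(i | i != J) poch (b J - b i + 2 - (m i)%:R) N
       / \prod_(i | i != J) poch (b i - (b J + 1)) (m i)
       / \prod_(i | i != J) poch (b J - b i + 1 + (i == j)%:R) l)
    * \prod_(i | i != J) (-1) ^+ u.
  rewrite -!(big_split, prodf_div); apply: eq_bigr => i iJ /=.
  have m1 : poch (b i - (b J + 1)) (m i) != 0.
    by apply: (m_neq0 i J 1) => //; lia.
  have mN : poch (b i - (b J + 1) - N%:R) (m i) != 0.
    have := m_neq0 _ _ _ iJ Nm; rewrite KE.
    by congr (poch _ _ != 0); ring.
  have c0 k : (k <= u + l)%N -> k%:R - (b i - (b J + 1)) != 0.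
    move=> kN; have -> : k%:R - (b i - (b J + 1)) = k.+1%:R - (b i - b J).
      by rewrite -natr1; ring.
    by apply: b_neq0 => //; lia.
  have -> : b i - (b J + N.+1%:R) = b i - (b J + 1) - N%:R by rewrite KE; ring.
  (* At [i = j] the linear factor is missing and the upper parameter is lowered by one, so
     [shifted_factor] replaces [shifted_factorS]. Hence the shift by [e_j] in the lower string. *)
  case: (altP (i =P j)) => [ij|ij].
    rewrite /= !mul1r.
    have -> : b i + (1 - b J - N.+1%:R) - 1%:R = b i - (b J + 1) - N%:R.
      by rewrite KE; ring.
    rewrite (shifted_factor F) //; last by move=> k /andP[_]; exact: c0.
    by congr (poch _ _ / _ / poch _ _ * _); ring.
  rewrite /= subr0.
  have -> : b i + (1 - b J - N.+1%:R) = b i - (b J + 1) + 1 - N%:R.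
    by rewrite KE; ring.
  rewrite (shifted_factorS F) // !mulrA.
  by congr (_ * poch _ _ / _ / poch _ _ * _); ring.
have sE := prod_signs F _ J u.
have sN : (-1) ^+ N * (-1) ^+ N = 1 :> F by rewrite -expr2 sqrr_sign.
have eC : mpoch (fun i => alpha i + (b J + N.+1%:R + 1)) n =
  mpoch (fun i => alpha i + (b J + 2)) n *
  (\prod_i poch (alpha i + (b J + 2) + (n i)%:R) N
     / \prod_i poch (alpha i + (b J + 2)) N).
  rewrite -mpoch_shift; last first.
    move=> i k; have := alpha_neq0 i J k.+1; rewrite -natr1.
    by congr (_ != 0); ring.
  by rewrite /mpoch; apply: eq_bigr => i _; congr poch; rewrite KE; ring.
rewrite /formula_coef /Defs.coefC /Koff /top_off /ratio1 /mpoch_del.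
rewrite !(pochs_cons, pochs_cat, pochs_entries, pochs_del, pochs_nil).
rewrite expr1n eC.
under [\prod_i poch (a i - b j) 1]eq_bigr do rewrite poch1.
under [\prod_(i < q | _) poch (b i - b j) 1]eq_bigr do rewrite poch1.
under [\prod_i poch (a i - (b J + N.+1%:R)) 1]eq_bigr do rewrite poch1.
under [\prod_i poch (a i - (b J + _)) 1]eq_bigr do rewrite poch1.
under [\prod_(i < q | _) poch (b i - (b J + N.+1%:R)) 1]eq_bigr do rewrite poch1.
under [\prod_(i < q | _) poch (b i - (b J + _)) 1]eq_bigr do rewrite poch1.
rewrite [\prod_(i | i != j) (b i - (b J + N.+1%:R))]dj.
rewrite [\prod_(i | i != j) (b i - (b J + _))]dj.
rewrite [\prod_i poch (b i + _ - _) u](bigD1 J) //= (negbTE Jj).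
have -> : b J + (1 - b J - N.+1%:R) - 0%:R = - N%:R by rewrite KE; ring.
have -> : b J - (b J + N.+1%:R) = - N.+1%:R by ring.
have -> : b J - (b J + 1) = - 1 by ring.
have -> : (m J - N.+1 - 1 = (m J - 1) - N - 1)%N by lia.
have eM : 1 - (m J - 1)%:R = 2 - (m J)%:R :> F.
  by rewrite natrB; [ring | lia].
have -> : (m J - 2 = m J - 1 - 1)%N by lia.
rewrite !invfM (fact_sub_poch F (m J - 1) N); last by lia.
rewrite eM factS natrM invfM 2!exprS.
(* Since [K! = K * N!], this [K] cancels against the factor [- K] of index [J]. *)
have K0 : N.+1%:R / N.+1%:R = 1 :> F by rewrite mulfV // pnatr_eq0.
move: eN eA eB sE sN.
set s := (-1) ^+ u; set sg := (-1) ^+ N.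
set S := \prod_(i < q) s; set S' := \prod_(i < q | i != J) s.
set AN := \prod_i (a i - (b J + N.+1%:R)); set A1 := \prod_i (a i - (b J + 1)).
set Au := \prod_i poch (a i + _) u.
set Bu := \prod_(i | i != J) poch (b i + _ - _) u.
set BN := \prod_(i | i != J) (if _ then _ else b i - (b J + N.+1%:R)).
set B1 := \prod_(i | i != J) (if _ then _ else b i - (b J + 1)).
set MN := \prod_(i | i != J) poch (b i - (b J + N.+1%:R)) (m i).
set M1 := \prod_(i | i != J) poch (b i - (b J + 1)) (m i).
set Al := \prod_i poch (b J - a i + 1) l.
set AlN := \prod_i poch (b J - a i + 2) N.
set Bl := \prod_(i | i != J) poch _ l.
set T := \prod_(i | i != J) poch _ N.
set al := mpoch _ _; set alN := \prod_(i < p) poch (_ + _%:R) N.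
set al0 := \prod_(i < p) poch _ N.
set A0 := \prod_(i < q) (a i - b j); set B0 := \prod_(i < q | i != j) _.
set f := (N`!)%:R^-1; set f' := (l`!)%:R^-1; set g := ((m J - 1 - 1)`!)%:R^-1.
set X := x ^+ u / _; set t := poch (2 - (m J)%:R) N.
set k := poch 1 u; set z := poch (- N%:R) u.
move: K0; set c := N.+1%:R => K0 eN eA eB sE sN.
transitivity (- (sg * sg) * (c / c) * al * alN / al0 * t * g * k * X * (f * z)
   * (AN^-1 / Au) * (BN * Bu / MN) * (A0 / B0)); first by ring.
rewrite sN K0 eN eA eB invr1 !mulr1 -[RHS]mulr1 -[X in _ = _ * X]sE; ring.
Qed.

Lemma top_diag_eq0 (j : 'I_q) k :
  (0 < m j <= k)%N -> pochs (top_diag b alpha n m j) k = 0.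
Proof.
move=> /andP[m0 mk]; rewrite pochs_cons (@poch_eq0 _ _ _ (m j - 1)) ?mul0r //.
  by lia.
by rewrite natrB //; ring.
Qed.

Lemma top_off_eq0 (J : 'I_q) k :
  (1 < m J <= k.+1)%N -> pochs (top_off b alpha n m J) k = 0.
Proof.
move=> /andP[m0 mk]; rewrite pochs_cons (@poch_eq0 _ _ _ (m J - 2)) ?mul0r //.
  by lia.
by rewrite natrB //; ring.
Qed.

(** The upper parameter of index [J] is [1 - K - delta], so the inner series stops at degree
    [K - 1 + delta]. *)
Lemma formula_expand (j : 'I_q) (x : F) :
  formula a b alpha n m j x =
  \sum_(J < q) \sum_(K < m J | (1 <= K + (j == J))%N)
    \sum_(u < K + (j == J)) formula_coef j J K u x.
Proof.
apply: eq_bigr => J _; apply: eq_bigr => K K1.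
rewrite (pFq_finite _ _ _ _ (K + (j == J))) ?mulr_sumr //.
move=> k Kk; rewrite pochs_cons pochs_entries (bigD1 J) //=.
rewrite [poch (b J + _ - _) k](@poch_eq0 _ _ _ (K + (j == J) - 1)).
- by rewrite mul0r mulr0.
- by lia.
- by rewrite [J == j]eq_sym natrB // natrD; ring.
Qed.

Lemma formula_kdf (j : 'I_q) (x : F) : (0 < m j)%N ->
  formula a b alpha n m j x =
  Kdiag b alpha n m j * Fdiag a b alpha n m j x
  + \sum_(J < q | (J != j) && (2 <= m J)%N)
      Koff a b alpha n m j J * Foff a b alpha n m j J x.
Proof.
move=> mj; rewrite formula_expand (bigD1 j) //=; congr (_ + _).
  rewrite /Fdiag (kdf_finite _ _ _ _ _ _ _ _ _ (m j)); last first.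
    by move=> k mk; rewrite top_diag_eq0 ?mj.
  rewrite eqxx (eq_bigl xpredT); last by move=> K; rewrite addn1.
  under eq_bigr do rewrite addn1.
  rewrite (sum_triangle _ (fun K u => formula_coef j j K u x)).
  rewrite mulr_sumr; apply: eq_bigr => u _; rewrite mulr_sumr.
  by apply: eq_bigr => l ul; rewrite diag_coef.
rewrite [RHS]big_mkcondr; apply: eq_bigr => J Jj.
rewrite eq_sym (negbTE Jj).
under eq_bigl do rewrite addn0.
under eq_bigr do rewrite addn0.
(* If [m J <= 1], no [K >= 1] is left and [J] contributes nothing. *)
case: ifP => [m2|m2]; last first.
  by rewrite big1 // => K K1; have := ltn_ord K; lia.
rewrite /Foff (kdf_finite _ _ _ _ _ _ _ _ _ (m J - 1)); last first.
  by move=> k mk; rewrite top_off_eq0 // m2; lia.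
rewrite -(big_mkord (fun K => (0 < K)%N)
  (fun K => \sum_(u < K) formula_coef j J K u x)).
(* [K = 0] is dropped, and [K] becomes [N.+1] with [N < m J - 1]. *)
rewrite big_ltn_cond /=; last by lia.
rewrite big_nat_cond (eq_bigl (fun K => (1 <= K < m J)%N && true)); last first.
  by move=> K; lia.
rewrite -big_nat_cond (big_addn 0 (m J) 1) big_mkord.
rewrite (eq_bigr (fun N : 'I_(m J - 1) =>
  \sum_(u < N.+1) formula_coef j J N.+1 u x)) => [|N _]; last by rewrite addn1.
rewrite (sum_triangle _ (fun K u => formula_coef j J K.+1 u x)).
rewrite mulr_sumr; apply: eq_bigr => u _; rewrite mulr_sumr.
by apply: eq_bigr => l ul; rewrite off_coef //; lia.
Qed.
End Coefficients.

Theorem corollary3p11 (R : realType) (p q : nat)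
    (hp : (1 <= p)%N) (hq : (1 <= q)%N)
    (a b : 'I_q -> R) (alpha : 'I_p -> R)
    (n : 'I_p -> nat) (m : 'I_q -> nat)
    (hab : forall j, -1 < a j < b j)
    (halpha : forall i r, -1 < alpha i + a r)
    (hnm : (\sum_j m j = (\sum_i n i).+1)%N)
    (hm : forall i j, `|(m i)%:Z - (m j)%:Z| <= 1)
    (hnodes : forall (i j : 'I_q) (k l : nat), (k < m i)%N -> (l < m j)%N ->
      - b i - k%:R = - b j - l%:R -> i = j /\ k = l)
    (hden : formula_defined a b m)
    (B : 'I_q -> {poly R[i]}) (hB : is_form a b alpha n m B) (j : 'I_q) :
  (m j = 0%N -> B j = 0) /\
  ((1 <= m j)%N ->
    [/\ forall x : R[i],
          (B j).[x] =
            Kdiag (emb b) (emb alpha) n m j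
              * Fdiag (emb a) (emb b) (emb alpha) n m j x
            + \sum_(J < q | (J != j) && (2 <= m J)%N)
                Koff (emb a) (emb b) (emb alpha) n m j J
                  * Foff (emb a) (emb b) (emb alpha) n m j J x,
        forall k : nat, (m j - 1 < k)%N ->
          pochs (top_diag (emb b) (emb alpha) n m j) k = 0
      & forall J : 'I_q, J != j -> (2 <= m J)%N ->
          forall k : nat, (m J - 2 < k)%N ->
            pochs (top_off (emb b) (emb alpha) n m J) k = 0]).
Proof.
case: hB => sizeB _ formB; split=> [mj0|mj].
  by apply/eqP; rewrite -size_poly_leq0 -mj0.
(* A zero would identify the nodes [- b i - l] and [- b J - k]. *)
have node_neq (i J : 'I_q) k l : i != J -> (l < m i)%N -> (k < m J)%N ->
    b i - (b J + k%:R) + l%:R != 0.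
  move=> iJ li kJ; apply/eqP => e; move/eqP: iJ; apply.
  by case: (hnodes i J l k li kJ) => //; lra.
have b_neq i J k : i != J -> (k < m J)%N -> k%:R - (b i - b J) != 0.
  move=> iJ kJ; have [mi0|mi_gt0] := posnP (m i).
    have k0 : k = 0%N by have := hm i J; rewrite mi0; lia.
    have [+ _] := hden J (leq_ltn_trans (leq0n _) kJ).
    rewrite pochs_del k0 sub0r oppr_eq0.
    by move=> /prodf_neq0/(_ i iJ); rewrite poch1.
  have := node_neq i J k 0%N iJ mi_gt0 kJ.
  by rewrite addr0 -oppr_eq0; congr (_ != 0); ring.
(* In the formula for component [J], the pair [(J, J)] admits every [k < m J], so its denominators
   supply all these factors. *)
have a_neq i J k : (k < m J)%N -> b J - a i + k%:R != 0.
  move=> kJ; have [_ /(_ J k kJ)] := hden J (leq_ltn_trans (leq0n _) kJ).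
  rewrite eqxx addn1 => /(_ isT)[_ + _].
  rewrite pochs_entries => /prodf_neq0/(_ i isT); rewrite poch1 -oppr_eq0.
  by congr (_ != 0); ring.
(* Positive, because [alpha_i + b_J > alpha_i + a_J > -1]. *)
have alpha_neq i J k : alpha i + (b J + 1) + k%:R != 0.
  have := halpha i J; have /andP[_] := hab J; have := ler0n R k.
  by move=> *; apply: lt0r_neq0; lra.
(* The conditions are proved over [R] and carried to [R[i]] by the injective embedding. *)
have nz (x : R) : x != 0 -> x%:C != 0 by rewrite fmorph_eq0.
split=> [x|k mk|J _ mJ k mk].
- rewrite formB // formula_kdf // /emb => i J k.
  + by have := nz _ (alpha_neq i J k); rewrite !(rmorphD, rmorph_nat, rmorph1).
  + move=> kJ; have := nz _ (a_neq i J k kJ).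
    by rewrite !(rmorphD, rmorphN, rmorph_nat).
  + move=> iJ kJ; have := nz _ (b_neq i J k iJ kJ).
    by rewrite !(rmorphD, rmorphN, rmorph_nat).
  (* The factors of this symbol are differences of nodes; for [m i = 0] it is an empty product. *)
  + move=> iJ kJ; apply: poch_neq0 => l li.
    have := nz _ (node_neq i J k l iJ li kJ).
    by rewrite !(rmorphD, rmorphN, rmorph_nat).
- by apply: top_diag_eq0; lia.
- by apply: top_off_eq0; lia.
Qed.
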